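(* Let $G$ be an undirected graph on $n$ nodes with Laplacian $L$ and a fixed eigendecomposition $L=U\Lambda U^\top$, where $U=[u_1,\dots,u_n]$ is orthogonal and $\Lambda=\mathrm{diag}(\lambda_1,\dots,\lambda_n)$. Let $g:\mathbb{R}^2\to\mathbb{R}$ be continuous and let $x\in\mathbb{R}^n$. Define $\mathcal E(x):=\sum_{i=1}^n \hat x_i\,u_iu_i^\top\in\mathbb{R}^{n\times n}$ with $\hat x_i:=u_i^\top x$, and for $H\in\mathbb{R}^{n\times n}$ define $\mathcal P(H):=\sum_{i,j=1}^n (u_i^\top H u_j)\,u_i\in\mathbb{R}^n$. Then $$\mathcal P\bigl(g(L\otimes I_n,\ I_n\otimes L)\,\mathcal E(x)\bigr)=U\,\tilde g(\Lambda)\,U^\top x,$$ where $\tilde g(\Lambda):=\mathrm{diag}\bigl(g(\lambda_1,\lambda_1),\dots,g(\lambda_n,\lambda_n)\bigr)$.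
   Context: The Laplacian is $L=D-A$ or $L=I-D^{-1/2}AD^{-1/2}$, where $A$ is the adjacency matrix and $D$ the degree matrix. A matrix in $\mathbb{R}^{n\times n}$ is identified with a vector in $\mathbb{R}^{n^2}$ via the column-stacking isomorphism $\mathrm{vec}$. For continuous $g:\mathbb{R}^2\to\mathbb{R}$, put $G_\lambda:=(g(\lambda_i,\lambda_j))_{1\le i,j\le n}$ and $G(\Lambda):=\mathrm{diag}(\mathrm{vec}(G_\lambda))\in\mathbb{R}^{n^2\times n^2}$, and define the full-spectrum convolution matrix $$g(L\otimes I_n,I_n\otimes L):=(U\otimes U)\,G(\Lambda)\,(U\otimes U)^\top\in\mathbb{R}^{n^2\times n^2},$$ where $\otimes$ is the Kronecker product. It acts on a matrix $\varepsilon\in\mathbb{R}^{n\times n}$ through the identification $\mathrm{vec}$, and the result is regarded again as an $n\times n$ matrix. *)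

(* Defs.v *)
From HB Require Import structures.
From mathcomp Require Import all_boot all_order all_algebra.
From mathcomp Require Import mxtens.
From mathcomp Require Import all_classical all_reals all_analysis.

Set Implicit Arguments.
Unset Strict Implicit.
Unset Printing Implicit Defensive.

Import Order.TTheory GRing.Theory Num.Theory.
Import numFieldNormedType.Exports.
Local Open Scope ring_scope.

Section GraphLaplacian.
Context {R : realType} {n : nat}.
Implicit Types e : rel 'I_n.

Definition adjacency_mx e : 'M[R]_n := \matrix_(i, j) (e i j)%:R.

Definition degree e (i : 'I_n) : nat := #|[pred j | e i j]|.

Definition degree_mx e : 'M[R]_n := diag_mx (\row_i (degree e i)%:R).

(* Since 0^-1 = 0, an isolated vertex gets the diagonal entry 0 in D^{-1/2}. *)
Definition degree_mx_invsqrt e : 'M[R]_n :=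
  diag_mx (\row_i (Num.sqrt (degree e i)%:R)^-1).

Definition laplacian e : 'M[R]_n := degree_mx e - adjacency_mx e.

Definition normalized_laplacian e : 'M[R]_n :=
  1%:M - degree_mx_invsqrt e *m adjacency_mx e *m degree_mx_invsqrt e.

Definition is_laplacian e (L : 'M[R]_n) : Prop :=
  L = laplacian e \/ L = normalized_laplacian e.

End GraphLaplacian.

Section ColumnStacking.
Context {R : realType} {n : nat}.

(* mxtens_index (j, i) is the position j * n + i, the index convention of the
   Kronecker product *t; so entry (i, j) of H goes to position j * n + i, i.e.
   the columns of H are stacked.  (mxvec would stack the rows.) *)
Definition vec (H : 'M[R]_n) : 'cV[R]_(n * n) :=
  \col_k H (mxtens_unindex k).2 (mxtens_unindex k).1.

Definition unvec (v : 'cV[R]_(n * n)) : 'M[R]_n :=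
  \matrix_(i, j) v (mxtens_index (j, i)) 0.

Lemma vecK : cancel vec unvec.
Proof. by move=> H; apply/matrixP=> i j; rewrite !mxE mxtens_indexK. Qed.

Lemma unvecK : cancel unvec vec.
Proof.
move=> v; apply/matrixP=> k l; case: (mxtens_indexP k) => i j.
by rewrite !mxE mxtens_indexK ord1.
Qed.

Lemma vec_mulmx (A X B : 'M[R]_n) :
  vec (A *m X *m B) = (B^T *t A) *m vec X.
Proof.
apply/matrixP=> k l; case: (mxtens_indexP k) => i j.
rewrite !mxE mxtens_indexK /= (reindex (@mxtens_index n n)) /=; last first.
  by exists (@mxtens_unindex n n) => p _; rewrite (mxtens_indexK, mxtens_unindexK).
under eq_bigr => a _ do rewrite mxE big_distrl /=.
rewrite pair_bigA /=; apply: eq_bigr => -[a b] _ /=.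
by rewrite !mxE !mxtens_indexK /= mulrC mulrA.
Qed.

End ColumnStacking.

Section FullSpectrumConvolution.
Context {R : realType} {n : nat}.
Implicit Types (g : R * R -> R) (U H : 'M[R]_n) (lam : 'rV[R]_n) (x : 'cV[R]_n).

Definition spectral_kernel g lam : 'M[R]_n :=
  \matrix_(i, j) g (lam 0 i, lam 0 j).

(* g(L (x) I_n, I_n (x) L), for the eigendecomposition L = U diag(lam) U^T. *)
Definition full_spectrum_mx g U lam : 'M[R]_(n * n) :=
  (U *t U) *m diag_mx (vec (spectral_kernel g lam))^T *m (U *t U)^T.

Definition full_spectrum_conv g U lam H : 'M[R]_n :=
  unvec (full_spectrum_mx g U lam *m vec H).

Definition graph_fourier U x (i : 'I_n) : R := ((col i U)^T *m x) 0 0.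

Definition embed U x : 'M[R]_n :=
  \sum_(i < n) graph_fourier U x i *: (col i U *m (col i U)^T).

Definition project U H : 'cV[R]_n :=
  \sum_(i < n) \sum_(j < n) ((col i U)^T *m H *m col j U) 0 0 *: col i U.

Definition diag_filter g lam : 'M[R]_n :=
  diag_mx (\row_i g (lam 0 i, lam 0 i)).

End FullSpectrumConvolution.

(* Main.v *)
(* Since (U *t U) vec X = vec (U X U^T), the convolution multiplies U^T H U
   entrywise by the kernel (g(lam_i, lam_j)).  For H = embed U x the matrix
   U^T H U is diag(U^T x), so only the values g(lam_i, lam_i) survive, and
   project U recovers U times the vector of row sums of that diagonal matrix. *)
Require Import Defs.
From mathcomp Require Import all_boot all_order all_algebra.
From mathcomp Require Import mxtens.
From mathcomp Require Import all_classical all_reals all_analysis.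
Import GRing.Theory.
Import numFieldNormedType.Exports.
Local Open Scope ring_scope.

Lemma graph_fourierE (R : realType) (n : nat) (U : 'M[R]_n) (x : 'cV[R]_n) i :
  graph_fourier U x i = (U^T *m x) i 0.
Proof. by rewrite /graph_fourier tr_col -row_mul mxE. Qed.

Lemma embedE (R : realType) (n : nat) (U : 'M[R]_n) (x : 'cV[R]_n) :
  embed U x = U *m diag_mx (U^T *m x)^T *m U^T.
Proof.
apply/matrixP => a b; rewrite mul_mx_diag summxE mxE.
apply: eq_bigr => i _.
by rewrite graph_fourierE !mxE big_ord1 !mxE mulrA [_ * U a i]mulrC.
Qed.

(** The coefficient of column [i] of [U] is the [i]-th row sum of [U^T *m H *m U]; multiplying by
    [const_mx 1] takes these sums. *)
Lemma projectE (R : realType) (n : nat) (U H : 'M[R]_n) :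
  project U H = U *m (U^T *m H *m U *m const_mx 1).
Proof.
apply/matrixP => a b; rewrite ord1 summxE mxE; apply: eq_bigr => i _.
rewrite summxE mxE mulr_sumr; apply: eq_bigr => j _.
by rewrite tr_col (colE j U) mulmxA -!row_mul -colE !mxE mulr1 mulrC.
Qed.

Lemma diag_mx_vec_mul (R : realType) (n : nat) (K X : 'M[R]_n) :
  diag_mx (vec K)^T *m vec X = vec (map2_mx *%R K X).
Proof. by apply/matrixP => k l; rewrite mul_diag_mx !mxE. Qed.

Lemma full_spectrum_convE (R : realType) (n : nat) (g : R * R -> R)
    (U H : 'M[R]_n) (lam : 'rV[R]_n) :
  full_spectrum_conv g U lam H =
  U *m map2_mx *%R (spectral_kernel g lam) (U^T *m H *m U) *m U^T.
Proof.
rewrite /full_spectrum_conv /full_spectrum_mx trmx_tens -!mulmxA.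
(* [-{1}[U]trmxK] writes the left tensor factor as [U^T^T], so that [vec_mulmx] applies backwards
   with [B = U^T]. *)
by rewrite -vec_mulmx diag_mx_vec_mul -{1}[U]trmxK -vec_mulmx vecK !mulmxA.
Qed.

(** Row [i] of the entrywise product vanishes off the diagonal, so its sum is the single term
    [g (lam 0 i, lam 0 i) * v i 0]. *)
Lemma spectral_kernel_diag (R : realType) (n : nat) (g : R * R -> R)
    (lam : 'rV[R]_n) (v : 'cV[R]_n) :
  map2_mx *%R (spectral_kernel g lam) (diag_mx v^T) *m const_mx 1 =
  diag_filter g lam *m v.
Proof.
apply/matrixP => i j; rewrite ord1 mul_diag_mx !mxE (bigD1 i) //= big1.
  by rewrite !mxE eqxx mulr1 addr0.
by move=> k /negPf ki; rewrite !mxE eq_sym ki mulr0 mul0r.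
Qed.

Theorem proposition3p3 (R : realType) (n : nat) (e : rel 'I_n)
    (e_sym : symmetric e)
    (L U : 'M[R]_n) (lam : 'rV[R]_n)
    (L_lap : is_laplacian e L)
    (U_orth : U^T *m U = 1%:M)
    (L_eig : L = U *m diag_mx lam *m U^T)
    (g : R * R -> R) (g_cont : continuous g) (x : 'cV[R]_n) :
  project U (full_spectrum_conv g U lam (embed U x)) =
  U *m diag_filter g lam *m U^T *m x.
Proof.
(* This cancels the basis changes twice: between [project] and the convolution, then between the
   convolution and [embed]. *)
have conjK X : U^T *m (U *m X *m U^T) *m U = X.
  by rewrite !mulmxA U_orth mul1mx -mulmxA U_orth mulmx1.
by rewrite projectE full_spectrum_convE embedE !conjK spectral_kernel_diag !mulmxA.
Qed.
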